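(* Let $p,q,r\in\mathbb{R}$ and let $\phi\colon\mathbb{D}_\infty\to\mathbb{R}$ be the function $$\phi(w)=\begin{cases}1&\text{if }w=e,\\ p&\text{if }w=s,\\ q&\text{if }w=t,\\ r&\text{otherwise.}\end{cases}$$ Then $\phi$ is positive definite on $\mathbb{D}_\infty$ if and only if $0\le r$ and $|p-r|+|q-r|\le 1-r$, i.e. if and only if $$\max\{0,\,p+q-1\}\le r\le\min\left\{1-|p-q|,\ \frac{1+p+q}{3}\right\}.$$
   Context: $\mathbb{D}_\infty=\langle s,t\mid s^2=t^2=1\rangle$ is the infinite dihedral group with Coxeter generators $s,t$. A function $\varphi\colon\Gamma\to\mathbb{C}$ on a group $\Gamma$ is positive definite if $\sum_{x,y\in\Gamma}\varphi(y^{-1}x)\alpha(x)\overline{\alpha(y)}\ge 0$ for every finitely supported $\alpha\colon\Gamma\to\mathbb{C}$. *)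

(* Defs.v *)
From HB Require Import structures.
From mathcomp Require Import all_boot all_order all_algebra.
From mathcomp Require Import finmap reals complex.

Set Implicit Arguments.
Unset Strict Implicit.
Unset Printing Implicit Defensive.

Import Order.TTheory GRing.Theory Num.Theory.
Local Open Scope ring_scope.

(* The infinite dihedral group <s, t | s^2 = t^2 = 1>.

    An element is represented by its unique reduced word in the letters s, t,
    i.e. a word without two equal consecutive letters; [false] stands for s and
    [true] for t. The product is concatenation followed by cancellation of
    squares. [dihedral_presentation] shows that this is the group presented by
    s^2 = t^2 = 1. *)

Definition reduced (w : seq bool) : bool := sorted (fun a b => a != b) w.

Record dihedral := Dihedral { word :> seq bool; _ : reduced word }.

HB.instance Definition _ := [isSub for word].
HB.instance Definition _ := [Countable of dihedral by <:].

(* Left multiplication of a reduced word by one letter. *)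
Definition push (a : bool) (w : seq bool) : seq bool :=
  if w is b :: w' then (if a == b then w' else a :: w) else [:: a].

Lemma push_reduced a w : reduced w -> reduced (push a w).
Proof.
case: w => [|b w] //= red_bw.
by case: eqVneq => [_|neq_ab] /=; [apply: path_sorted red_bw | rewrite neq_ab].
Qed.

Lemma pushK a w : reduced w -> push a (push a w) = w.
Proof.
case: w => [|b w] /=; first by rewrite eqxx.
case: eqVneq => [<-|_] /=; last by rewrite eqxx.
by case: w => [|c w] //= /andP[/negPf->].
Qed.

Lemma cons_push a w : reduced (a :: w) -> push a w = a :: w.
Proof. by case: w => [|b w] //= /andP[/negPf->]. Qed.

Lemma foldr_push_reduced v w : reduced w -> reduced (foldr push w v).
Proof. by move=> red_w; elim: v => //= a v; apply: push_reduced. Qed.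

Lemma foldr_push_push w a v :
  reduced w -> foldr push w (push a v) = push a (foldr push w v).
Proof.
case: v => [|b v] //= red_w; case: eqVneq => [->|//].
by rewrite pushK // foldr_push_reduced.
Qed.

Lemma foldr_push_nil v : reduced v -> foldr push [::] v = v.
Proof.
elim: v => // a v IH red_av /=.
by rewrite IH ?cons_push //; apply: path_sorted red_av.
Qed.

Lemma rev_reduced w : reduced w -> reduced (rev w).
Proof.
rewrite /reduced rev_sorted => red_w.
by apply: sub_sorted red_w => a b; rewrite eq_sym.
Qed.

Definition dihedral_mul (x y : dihedral) : dihedral :=
  Dihedral (foldr_push_reduced x (valP y)).
Definition dihedral_one : dihedral := @Dihedral [::] isT.
Definition dihedral_inv (x : dihedral) : dihedral :=
  Dihedral (rev_reduced (valP x)).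

Lemma dihedral_mulA : associative dihedral_mul.
Proof.
move=> x y z; apply: val_inj => /=.
elim: (val x) => //= a u ->.
by rewrite foldr_push_push //; apply: valP.
Qed.

Lemma dihedral_mul1 : left_id dihedral_one dihedral_mul.
Proof. by move=> x; apply: val_inj. Qed.

Lemma dihedral_1mul : right_id dihedral_one dihedral_mul.
Proof. by move=> x; apply: val_inj; rewrite /= foldr_push_nil //; apply: valP. Qed.

Lemma foldr_push_rev v w : reduced w -> foldr push (foldr push w v) (rev v) = w.
Proof.
elim: v w => //= a v IH w red_w.
by rewrite rev_cons foldr_rcons pushK ?IH // foldr_push_reduced.
Qed.

Lemma dihedral_mulV : left_inverse dihedral_one dihedral_inv dihedral_mul.
Proof.
move=> x; apply: val_inj => /=.
by rewrite -{1}(foldr_push_nil (valP x)) foldr_push_rev.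
Qed.

Lemma dihedral_Vmul : right_inverse dihedral_one dihedral_inv dihedral_mul.
Proof.
move=> x; have invK : dihedral_inv (dihedral_inv x) = x.
  by apply: val_inj; rewrite /= revK.
by rewrite -{1}invK dihedral_mulV.
Qed.

HB.instance Definition _ := isGroup.Build dihedral
  dihedral_mulA dihedral_mul1 dihedral_1mul dihedral_mulV dihedral_Vmul.

Definition dihedral_s : dihedral := @Dihedral [:: false] isT.
Definition dihedral_t : dihedral := @Dihedral [:: true] isT.

Lemma dihedral_ss : (dihedral_s * dihedral_s = 1)%g.
Proof. exact: val_inj. Qed.

Lemma dihedral_tt : (dihedral_t * dihedral_t = 1)%g.
Proof. exact: val_inj. Qed.

Lemma dihedral_presentation (H : groupType) (a b : H) :
    (a * a = 1)%g -> (b * b = 1)%g ->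
  exists2 f : dihedral -> H,
    [/\ {morph f : x y / (x * y)%g}, f dihedral_s = a & f dihedral_t = b]
  & forall g : dihedral -> H,
    [/\ {morph g : x y / (x * y)%g}, g dihedral_s = a & g dihedral_t = b] ->
    g =1 f.
Proof.
move=> aa bb; pose letter (c : bool) := if c then b else a.
pose ev (w : seq bool) := foldr (fun c h => (letter c * h)%g) 1%g w.
have letterK c h : (letter c * (letter c * h) = h)%g.
  by rewrite mulgA; case: c; rewrite /= ?aa ?bb mul1g.
have ev_push c w : ev (push c w) = (letter c * ev w)%g.
  by case: w => [|d w] //=; case: eqVneq => [->|] //=; rewrite letterK.
exists (fun x => ev (val x)).
  split; rewrite /= ?mulg1 // => x y /=.
  elim: (val x) => [|c w IH] /=; first by rewrite mul1g.
  by rewrite ev_push IH mulgA.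
move=> g [gM gs gt] [w red_w] /=; elim: w red_w => [|c w IH] red_cw.
  have -> : Dihedral red_cw = 1%g by apply: val_inj.
  by apply: (mulgI (g 1%g)); rewrite -gM !mulg1.
have red_w : reduced w by apply: path_sorted red_cw.
pose x : dihedral := if c then dihedral_t else dihedral_s.
have -> : Dihedral red_cw = (x * Dihedral red_w)%g.
  by apply: val_inj; rewrite -[LHS](cons_push red_cw) /x; case: (c).
by rewrite gM IH /x; case: (c); rewrite ?gs ?gt.
Qed.

(* In [R[i]], [0 <= z] means that z is real and nonnegative. *)
Definition positive_definite (R : realType) (G : groupType) (phi : G -> R[i])
    : Prop :=
  forall alpha : {fsfun G -> R[i] with 0},
    0 <= \sum_(x <- finsupp alpha) \sum_(y <- finsupp alpha)
           phi (y^-1 * x)%g * alpha x * (alpha y)^*.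

Definition dihedral_fun (R : realType) (p q r : R) (w : dihedral) : R :=
  if w == 1%g then 1
  else if w == dihedral_s then p
  else if w == dihedral_t then q
  else r.

(* Main.v *)
Require Import Defs.
From mathcomp Require Import all_boot all_order all_algebra.
From mathcomp Require Import finmap reals complex.
From mathcomp Require Import ring lra zify.

(** Write [d_g] for the indicator function of [g]. The function of the theorem is
    [r + (1 - r) d_1 + (p - r) d_s + (q - r) d_t].

    Sufficiency. For an involution [a] the functions [d_1 + d_a] and [d_1 - d_a]
    are positive definite, being the two characters of the subgroup [{1, a}]
    extended by zero ([positive_definite_pair]); so is the constant function 1.
    When [0 <= r] and [|p - r| + |q - r| <= 1 - r], the function above is a
    combination of these with nonnegative coefficients: a summand
    [u d_1 + v d_a] with [|v| <= u] equals
    [(u + v)/2 (d_1 + d_a) + (u - v)/2 (d_1 - d_a)], and [(1 - r) d_1] can be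
    split into [(1 - r - |q - r|) d_1] to go with [(p - r) d_s] and
    [|q - r| d_1] to go with [(q - r) d_t].

    Necessity. Along the geodesic ray [1, s, st, sts, ...] of the Cayley graph,
    whose edges are alternately labelled [s] and [t], the quadratic form of the
    function at real weights [c_0, ..., c_n] is
    [r (sum c_i)^2 + (1 - r) sum c_i^2 + 2 sum e_i c_i c_(i+1)], with [e_i] equal
    to [p - r] on [s]-edges and to [q - r] on [t]-edges ([ray_form]). Putting
    weight 1 on every second vertex kills the last term, and the quadratic
    growth of the first one forces [0 <= r]. Weights [+1] and [-1] with a
    prescribed sign change [x] along all [s]-edges and [y] along all [t]-edges
    give [1 - r + x (p - r) + y (q - r) >= 0] per vertex in the limit of long
    rays, provided that [sum c_i = 0]; this is arranged by following a pattern
    by its negative, which spoils a single edge ([ray_form_antiperiodic_ge0]).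
    The four choices of [(x, y)] amount to
    [|p - r| + |q - r| <= 1 - r]. *)

Set Implicit Arguments.
Unset Strict Implicit.
Unset Printing Implicit Defensive.

Import Order.TTheory GRing.Theory Num.Theory.
Local Open Scope ring_scope.

(** * Positive definite functions on a group *)

Section PositiveDefinite.
Variables (R : realType) (G : groupType).
Implicit Types (phi psi : G -> R[i]).

Lemma eq_positive_definite phi psi :
  phi =1 psi -> positive_definite phi -> positive_definite psi.
Proof.
move=> eq_phi pd alpha; rewrite (le_trans (pd alpha)) // le_eqVlt.
by apply/orP; left; apply/eqP; do 2!apply: eq_bigr => ? _; rewrite eq_phi.
Qed.

Lemma positive_definiteD phi psi :
  positive_definite phi -> positive_definite psi ->
  positive_definite (fun x => phi x + psi x).
Proof.
move=> pd1 pd2 alpha; rewrite (le_trans (addr_ge0 (pd1 alpha) (pd2 alpha))) //.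
rewrite -big_split le_eqVlt; apply/orP; left; apply/eqP.
apply: eq_bigr => x _; rewrite -big_split.
by apply: eq_bigr => y _ /=; rewrite !mulrDl.
Qed.

Lemma positive_definiteZ (c : R) phi :
  0 <= c -> positive_definite phi -> positive_definite (fun x => c%:C%C * phi x).
Proof.
move=> c0 pd alpha; have cC : 0 <= c%:C%C by rewrite ler0c.
rewrite (le_trans (mulr_ge0 cC (pd alpha))) // mulr_sumr le_eqVlt.
apply/orP; left; apply/eqP.
apply: eq_bigr => x _; rewrite mulr_sumr.
by apply: eq_bigr => y _ /=; rewrite !mulrA.
Qed.

Lemma positive_definite_cst1 : positive_definite (fun _ : G => 1 : R[i]).
Proof.
move=> alpha; under eq_bigr => x _ do
  under eq_bigr => y _ do rewrite mul1r.
under eq_bigr => x _ do rewrite -mulr_sumr.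
by rewrite -mulr_suml -rmorph_sum mul_conjC_ge0.
Qed.

(** Sums over the exact support are rigid; this replaces the support by a larger
    set with better invariance properties. *)
Lemma finsupp_sumE (alpha : {fsfun G -> R[i] with 0}) (B : {fset G})
    (F : G -> R[i]) :
  (finsupp alpha `<=` B)%fset -> (forall x, alpha x = 0 -> F x = 0) ->
  \sum_(x <- finsupp alpha) F x = \sum_(x <- B) F x.
Proof.
move=> sAB F0; apply: big_fset_incl => // x _ xA.
by apply: F0; apply: fsfun_dflt.
Qed.

Lemma big_fset_pick (B : {fset G}) (z : G) (F : G -> R[i]) :
  z \in B -> \sum_(x <- B) (x == z)%:R * F x = F z.
Proof.
move=> zB; rewrite (big_fsetD1 z) //= eqxx mul1r big_seq big1 ?addr0 // => x.
by rewrite !inE => /andP[/negPf-> _]; rewrite mul0r.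
Qed.

(** A character of the subgroup [{1, a}], extended by zero: its quadratic form at
    [alpha] is half the sum over [y] of [|alpha y + e alpha (y a)|^2], because
    [y -> y a] is an involution and so exchanges the two mixed terms of the
    expanded squares. *)
Lemma positive_definite_pair (a : G) (b : bool) : (a * a = 1)%g ->
  positive_definite (fun x => (x == 1%g)%:R + (-1) ^+ b * (x == a)%:R : R[i]).
Proof.
move=> aa alpha; set A := finsupp alpha; set e : R[i] := (-1) ^+ b.
have aK x : (x * a * a = x)%g by rewrite -mulgA aa mulg1.
(* The support made stable under right multiplication by [a], so that sums can
   be reindexed along [y -> y a]. *)
pose B : {fset G} := (A `|` [fset (x * a)%g | x in A])%fset.
have BE x : (x \in B) = (x \in A) || ((x * a)%g \in A).
  rewrite inE; congr (_ || _); apply/imfsetP/idP => [[y /= yA ->]|xaA].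
    by rewrite aK.
  by exists (x * a)%g => //; rewrite aK.
have Ba x : ((x * a)%g \in B) = (x \in B) by rewrite !BE aK orbC.
have sAB : (A `<=` B)%fset by apply: fsubsetUl.
have reidx (F : G -> R[i]) : \sum_(x <- B) F (x * a)%g = \sum_(x <- B) F x.
  rewrite -(big_map (fun x => x * a)%g xpredT F); apply: perm_big.
  apply: uniq_perm; rewrite ?fset_uniq //.
    by rewrite map_inj_uniq ?fset_uniq //; apply: mulIg.
  move=> x; rewrite -[RHS]Ba; apply/mapP/idP => [[y yB ->]|xB].
    by rewrite aK.
  by exists (x * a)%g; rewrite ?aK.
suff -> : \sum_(x <- A) \sum_(y <- A)
    ((y^-1 * x == 1)%g%:R + e * (y^-1 * x == a)%g%:R) * alpha x * (alpha y)^*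
  = 2^-1 * \sum_(y <- B) `|alpha y + e * alpha (y * a)%g| ^+ 2.
  apply: mulr_ge0; first by rewrite invr_ge0 ler0n.
  by apply: sumr_ge0 => y _; apply: exprn_ge0.
have ->: \sum_(x <- A) \sum_(y <- A)
    ((y^-1 * x == 1)%g%:R + e * (y^-1 * x == a)%g%:R) * alpha x * (alpha y)^*
  = \sum_(y <- B) (alpha y + e * alpha (y * a)%g) * (alpha y)^*.
  rewrite exchange_big /= (finsupp_sumE sAB); last first.
    by move=> y y0; rewrite big1 // => x _; rewrite y0 conjC0 mulr0.
  apply: eq_big_seq => y yB; rewrite (finsupp_sumE sAB); last first.
    by move=> x ->; rewrite mulr0 mul0r.
  rewrite -mulr_suml; congr (_ * _).
  rewrite -[in RHS](@big_fset_pick B y (fun x => alpha x)) //.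
  rewrite -[in RHS](@big_fset_pick B (y * a)%g (fun x => alpha x)) ?Ba //.
  rewrite mulr_sumr -big_split; apply: eq_bigr => x _ /=.
  have E z : (y^-1 * x == z)%g = (x == y * z)%g.
    by rewrite -(inj_eq (mulgI y)) mulgA mulgV mul1g.
  by rewrite !E mulg1 mulrDl mulrA.
have ee : e * e = 1 by rewrite -expr2 sqrr_sign.
have ec : e^* = e by rewrite rmorph_sign.
apply: (@mulfI _ 2); first by rewrite pnatr_eq0.
rewrite [RHS]mulrA divff ?pnatr_eq0 // mul1r mulr_natl mulr2n.
rewrite -[in X in _ + X]reidx -big_split; apply: eq_bigr => y _ /=.
rewrite aK normCK rmorphD rmorphM /= ec.
set u := alpha y; set v := alpha _.
have -> : (u + e * v) * (u^* + e * v^*)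
    = u * u^* + e * (u * v^*) + e * (v * u^*) + (e * e) * (v * v^*) by ring.
rewrite ee; ring.
Qed.

(** The form in which positive definiteness is tested on a finite family of
    points. Repetitions among the [w i] are harmless, as the weights of equal
    points simply add up in [alpha]. *)
Lemma positive_definite_tuple phi (n : nat) (w : nat -> G) (c : nat -> R[i]) :
  positive_definite phi ->
  0 <= \sum_(i < n) \sum_(j < n) phi ((w j)^-1 * w i)%g * c i * (c j)^*.
Proof.
move=> pd.
pose S : {fset G} := [fset w (val i) | i : 'I_n]%fset.
have wS (i : 'I_n) : w i \in S by apply: in_imfset.
pose alpha : {fsfun G -> R[i] with 0} :=
  [fsfun x in S => \sum_(i < n) (x == w i)%:R * c i].
have alphaE x : x \in S -> alpha x = \sum_(i < n) (x == w i)%:R * c i.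
  by move=> xS; rewrite fsfunE xS.
have sS : (finsupp alpha `<=` S)%fset by apply: finsupp_sub.
have := pd alpha.
rewrite (finsupp_sumE sS); last first.
  by move=> x x0; rewrite big1 // => y _; rewrite x0 mulr0 mul0r.
under eq_bigr => x _ do
  (rewrite (finsupp_sumE sS); last by move=> y ->; rewrite conjC0 mulr0).
suff -> : \sum_(x <- S) \sum_(y <- S) phi (y^-1 * x)%g * alpha x * (alpha y)^*
  = \sum_(i < n) \sum_(j < n) phi ((w j)^-1 * w i)%g * c i * (c j)^* by [].
have E (F : G -> R[i]) :
    \sum_(x <- S) F x * alpha x = \sum_(i < n) F (w i) * c i.
  under eq_big_seq => x xS do rewrite alphaE // mulr_sumr.
  rewrite exchange_big /=; apply: eq_bigr => i _.
  rewrite -(@big_fset_pick S (w i) (fun x => F x * c i)) //.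
  by apply: eq_bigr => x _; rewrite mulrCA.
have E' (F : G -> R[i]) :
    \sum_(x <- S) F x * (alpha x)^* = \sum_(i < n) F (w i) * (c i)^*.
  apply: (can_inj conjCK); rewrite !rmorph_sum /=.
  under eq_bigr => x _ do rewrite rmorphM /= conjCK.
  by rewrite E; apply: eq_bigr => i _; rewrite rmorphM /= conjCK.
under eq_bigr => x _ do rewrite E'.
rewrite exchange_big /= [RHS]exchange_big; apply: eq_bigr => j _ /=.
by rewrite -!mulr_suml E.
Qed.

End PositiveDefinite.

Lemma positive_definite_real_tuple (R : realType) (G : groupType) (f : G -> R)
    (n : nat) (w : nat -> G) (c : nat -> R) :
  positive_definite (fun x => (f x)%:C%C) ->
  0 <= \sum_(i < n) \sum_(j < n) f ((w j)^-1 * w i)%g * (c i * c j).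
Proof.
move=> pd; rewrite -ler0c !rmorph_sum /=.
have := @positive_definite_tuple R G _ n w (fun i => (c i)%:C%C) pd.
congr (0 <= _); apply: eq_bigr => i _; rewrite rmorph_sum /=.
apply: eq_bigr => j _; rewrite !rmorphM /= mulrA; congr (_ * _).
by rewrite conj_Creal // complex_real.
Qed.

(** * A geodesic ray in the Cayley graph *)

Section Ray.

Fact ray_subproof n : reduced (traject negb false n).
Proof.
have alt b : path (fun x y => x != y) b (traject negb (~~ b) n).
  by elim: n b => //= n IH b; rewrite IH andbT; case: b.
exact: path_sorted (alt true).
Qed.

(** The vertices [1, s, st, sts, ...]. *)
Definition ray (n : nat) : dihedral := Dihedral (ray_subproof n).

Lemma ray_inj : injective ray.
Proof.
by move=> i j /(congr1 (fun x => size (word x))); rewrite /= !size_traject.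
Qed.

Definition letter (b : bool) : dihedral := if b then dihedral_t else dihedral_s.

Lemma letter2 b : (letter b * letter b = 1)%g.
Proof. by case: b; rewrite /= ?dihedral_ss ?dihedral_tt. Qed.

Lemma raySr n : (ray n * letter (odd n))%g = ray n.+1.
Proof.
apply: val_inj; rewrite -[RHS]foldr_push_nil; last exact: ray_subproof.
have iterE : iter n negb false = odd n by elim: n => //= n ->.
(* Every reduced word is the reduction of itself, so both sides are products of
   the same list of letters. *)
change (foldr push (letter (odd n)) (traject negb false n) =
  foldr push [::] (traject negb false n.+1)).
rewrite trajectSr iterE foldr_rcons.
by rewrite /letter; case: (odd n).
Qed.

Lemma size_mul_letter (x : dihedral) b :
  (size (word (x * letter b)%g) <= (size (word x)).+1)%N.
Proof.
have push_size a w : (size (push a w) <= (size w).+1)%N.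
  by case: w => //= d w; case: ifP => //= _; lia.
suff H v : (size (foldr push (letter b) v) <= (size v).+1)%N by apply: H.
elim: v => [|a v IH] /=; first by case: b.
exact: leq_trans (push_size _ _) _.
Qed.

Lemma ray_diffS n : ((ray n)^-1 * ray n.+1)%g = letter (odd n).
Proof. by rewrite -raySr mulgA mulVg mul1g. Qed.

(** The ray is geodesic: right multiplication by a generator lengthens a reduced
    word by at most one, so the neighbours of [ray i] have length at most
    [i.+1 < j]. *)
Lemma ray_diff_far i j : (i.+1 < j)%N ->
  [/\ ((ray i)^-1 * ray j)%g != 1%g, ((ray i)^-1 * ray j)%g != dihedral_s
    & ((ray i)^-1 * ray j)%g != dihedral_t].
Proof.
move=> ij.
have E z : ((ray i)^-1 * ray j == z)%g = (ray j == ray i * z)%g.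
  by rewrite -(inj_eq (mulgI (ray i))) mulgA mulgV mul1g.
have F b : ((ray i)^-1 * ray j)%g != letter b.
  rewrite E; apply/eqP => H; have := size_mul_letter (ray i) b.
  by rewrite -H /= !size_traject; lia.
split; [|exact: F false|exact: F true].
by rewrite E mulg1 (inj_eq ray_inj); lia.
Qed.

End Ray.

(** * Sums by parity and linear growth *)

Lemma sum_parity (R : realType) (F : bool -> R) m :
  \sum_(i < m.*2) F (odd i) = m%:R * (F false + F true).
Proof.
elim: m => [|m IH]; first by rewrite big_ord0 mul0r.
by rewrite doubleS !big_ord_recr /= IH odd_double -natr1; ring.
Qed.

Lemma natmul_bound_ge0 (R : realType) (a b : R) :
  (forall n : nat, 0 <= b + n%:R * a) -> 0 <= a.
Proof.
move=> H; rewrite leNgt; apply/negP => a0.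
have := H (Num.bound (b / - a)).
have : b / - a < (Num.bound (b / - a))%:R.
  have := H 0; rewrite mul0r addr0 => b0.
  by apply: archi_boundP; rewrite divr_ge0 // oppr_ge0 ltW.
by rewrite ltr_pdivrMr ?oppr_gt0 //; lra.
Qed.

(** * Necessity: the quadratic form along the ray *)

Section Necessity.
Variables (R : realType) (p q r : R).
Let phi := @dihedral_fun R p q r.

Lemma dihedral_funV x : phi x^-1%g = phi x.
Proof.
rewrite /phi /dihedral_fun invg_eq1.
have E b : (x^-1 == letter b)%g = (x == letter b).
  have -> : letter b = ((letter b)^-1)%g :> dihedral.
    by apply: (mulgI (letter b)); rewrite letter2 mulgV.
  by rewrite (inj_eq invg_inj); case: b.
by rewrite (E false) (E true).
Qed.

(** The excess over the generic value [r] on the [i]-th edge of the ray, which is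
    an [s]-edge when [i] is even and a [t]-edge when [i] is odd. *)
Definition edge i := (if odd i then q else p) - r.

Lemma dihedral_fun_diff i : phi ((ray i)^-1 * ray i)%g = 1.
Proof. by rewrite mulVg /phi /dihedral_fun eqxx. Qed.

Lemma dihedral_fun_diffS i : phi ((ray i)^-1 * ray i.+1)%g = edge i + r.
Proof.
by rewrite ray_diffS /edge subrK /phi /dihedral_fun; case: (odd i).
Qed.

Lemma dihedral_fun_diff_far i j : (i.+1 < j)%N -> phi ((ray i)^-1 * ray j)%g = r.
Proof.
move=> /ray_diff_far[/negPf neq1 /negPf neqs /negPf neqt].
by rewrite /phi /dihedral_fun neq1 neqs neqt.
Qed.

(** Only consecutive points of the ray differ by a generator, so the matrix of
    the form is [r] everywhere, plus [1 - r] on the diagonal and [edge] next to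
    it. *)
Lemma ray_form (n : nat) (c : nat -> R) :
  \sum_(i < n.+1) \sum_(j < n.+1) phi ((ray j)^-1 * ray i)%g * (c i * c j) =
    r * (\sum_(i < n.+1) c i) ^+ 2 + (1 - r) * \sum_(i < n.+1) c i ^+ 2
    + 2 * \sum_(i < n) edge i * (c i * c i.+1).
Proof.
have sym i j : phi ((ray i)^-1 * ray j)%g = phi ((ray j)^-1 * ray i)%g.
  by rewrite -dihedral_funV invgM invgK.
elim: n => [|n IH].
  by rewrite !big_ord1 big_ord0 dihedral_fun_diff; ring.
rewrite big_ord_recr /=.
under eq_bigr => i _ do rewrite big_ord_recr /=.
rewrite big_split /= IH [X in _ + X]big_ord_recr /= dihedral_fun_diff.
have -> : \sum_(j < n.+1) phi ((ray j)^-1 * ray n.+1)%g * (c n.+1 * c j) =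
   c n.+1 * (r * \sum_(j < n.+1) c j + edge n * c n).
  rewrite !big_ord_recr /= dihedral_fun_diffS.
  under eq_bigr => i _ do rewrite dihedral_fun_diff_far ?ltnS //.
  by rewrite -!mulr_sumr; ring.
have -> : \sum_(j < n.+1) phi ((ray n.+1)^-1 * ray j)%g * (c j * c n.+1) =
   c n.+1 * (r * \sum_(j < n.+1) c j + edge n * c n).
  rewrite !big_ord_recr /= sym dihedral_fun_diffS.
  under eq_bigr => i _ do
    rewrite sym dihedral_fun_diff_far ?ltnS // [c _ * _]mulrC.
  by rewrite -!mulr_sumr; ring.
rewrite [\sum_(i < n.+2) c i]big_ord_recr [\sum_(i < n.+2) _ ^+ _]big_ord_recr.
rewrite [\sum_(i < n.+1) (edge _ * _)]big_ord_recr /=; ring.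
Qed.

Hypothesis pd : positive_definite (fun w => (phi w)%:C%C).

Lemma ray_form_ge0 n (c : nat -> R) :
  0 <= r * (\sum_(i < n.+1) c i) ^+ 2 + (1 - r) * \sum_(i < n.+1) c i ^+ 2
    + 2 * \sum_(i < n) edge i * (c i * c i.+1).
Proof. by rewrite -ray_form; apply: positive_definite_real_tuple. Qed.

(** Weight 1 on every second vertex: [n.+1] points at pairwise generic position,
    where the form is [n.+1 * (1 + n * r)]. *)
Lemma limit_value_ge0 : 0 <= r.
Proof.
apply: (@natmul_bound_ge0 R _ 1) => n.
have := @ray_form_ge0 n.*2.+1 (fun i => (~~ odd i)%:R).
rewrite [X in _ + 2 * X]big1 ?mulr0 ?addr0; last first.
  by move=> i _ /=; case: (odd i); rewrite ?mulr0 ?mul0r ?mulr0.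
rewrite -doubleS (@sum_parity R (fun b => (~~ b)%:R)).
rewrite (@sum_parity R (fun b => (~~ b)%:R ^+ 2)) /= expr0n expr1n !addr0 !mulr1.
have -> : r * n.+1%:R ^+ 2 + (1 - r) * n.+1%:R = n.+1%:R * (1 + n%:R * r).
  by rewrite -natr1; ring.
by rewrite pmulr_rge0 ?ltr0n.
Qed.

(** Continuing the weights [c_0, ..., c_n] by [-c_0, ..., -c_n] removes the term
    in [r]: the total weight is zero, the remaining terms double up, and the only
    new contribution comes from the edge that joins the two blocks. As [n] is
    odd, a block has even length and the labels of the edges repeat. *)
Lemma ray_form_antiperiodic_ge0 n (c : nat -> R) : odd n ->
  0 <= 2 * ((1 - r) * \sum_(i < n.+1) c i ^+ 2
              + 2 * \sum_(i < n) edge i * (c i * c i.+1))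
       - 2 * edge n * (c n * c 0).
Proof.
move=> n_odd.
pose d i := if (i <= n)%N then c i else - c (i - n.+1)%N.
have dl i : (i <= n)%N -> d i = c i by rewrite /d => ->.
have dr i : d (n.+1 + i)%N = - c i.
  by rewrite /d leqNgt leq_addr /= addKn.
have edger i : edge (n.+1 + i) = edge i by rewrite /edge oddD /= n_odd.
have := @ray_form_ge0 (n + n.+1) d; rewrite -addSn.
rewrite !big_split_ord /=.
under eq_bigr => i _ do rewrite dl -1?ltnS //.
under [X in r * (_ + X) ^+ 2]eq_bigr => i _ do rewrite dr.
rewrite sumrN subrr expr0n mulr0 add0r.
under eq_bigr => i _ do rewrite dl -1?ltnS //.
under [X in (1 - r) * (_ + X)]eq_bigr => i _ do rewrite dr sqrrN.
under [X in 2 * (X + \sum_(i < n.+1) _)]eq_bigr => i _ do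
  rewrite (dl _ (ltn_ord i)) (dl _ (ltnW (ltn_ord i))).
have -> : \sum_(i < n.+1) edge (n + i) * (d (n + i)%N * d (n + i).+1) =
    - edge n * (c n * c 0) + \sum_(i < n) edge i * (c i * c i.+1).
  rewrite big_ord_recl /= addn0 dl // -[in d n.+1](addn0 n.+1) dr.
  rewrite mulrN mulrN -mulNr; congr (_ + _); apply: eq_bigr => i _.
  by rewrite /bump /= add1n addnS -addSn edger -addnS !dr mulrNN.
by congr (0 <= _); ring.
Qed.

(** Signs along the ray, as exponents of [-1], with change [e false] across each
    [s]-edge and [e true] across each [t]-edge. *)
Fixpoint sign_walk (e : bool -> bool) (i : nat) : bool :=
  if i is i'.+1 then sign_walk e i' (+) e (odd i') else false.

(** With signs as weights each vertex contributes [1 - r] and each edge its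
    signed excess; there are as many [s]-edges as [t]-edges up to a bounded
    error, so the asserted quantity is the density of the form in the limit. *)
Lemma edge_signs_ge0 (e : bool -> bool) :
  0 <= 1 - r + (-1) ^+ e false * (p - r) + (-1) ^+ e true * (q - r).
Proof.
set A := _ * (p - r); set B := _ * (q - r).
suff: 0 <= 4 * (1 - r + A + B) by lra.
(* On two blocks of length [2 m + 2] there are [2 m + 2] edges labelled [s] and
   [2 m] labelled [t] inside the blocks; the edge between them is only bounded,
   by [2 |q - r|]. *)
apply: (@natmul_bound_ge0 R _ (4 * (1 - r) + 4 * A + 2 * `|q - r|)) => m.
have := @ray_form_antiperiodic_ge0 m.*2.+1 (fun i => (-1) ^+ sign_walk e i).
rewrite /= odd_double => /(_ isT).
under eq_bigr => i _ do rewrite sqrr_sign.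
rewrite sumr_const card_ord.
pose F b := if b then B else A.
under eq_bigr => i _.
  have -> : edge i * ((-1) ^+ sign_walk e i * (-1) ^+ sign_walk e i.+1)
      = F (odd i).
    rewrite /= -signr_addb addKb /edge /F /A /B.
    by case: (odd i); rewrite mulrC.
  over.
rewrite big_ord_recr /= (sum_parity F) odd_double /F /edge /= odd_double /= mulr1.
set sgn := _ ^+ _ => H; apply: le_trans H _.
have : - ((q - r) * sgn) <= `|q - r|.
  by rewrite (le_trans (ler_norm _)) // normrN normrM normr_sign mulr1.
rewrite -doubleS -mul2n natrM -natr1; lra.
Qed.

End Necessity.

(** * Sufficiency: a conical combination of characters *)

Lemma positive_definite_dihedral_fun (R : realType) (p q r : R) :
  0 <= r -> `|p - r| + `|q - r| <= 1 - r ->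
  positive_definite (fun w : dihedral => (dihedral_fun p q r w)%:C%C).
Proof.
move=> r0 H.
have Hp : `|p - r| <= 1 - r - `|q - r| by lra.
move: Hp; rewrite ler_norml => /andP[Hp1 Hp2].
have : `|q - r| <= `|q - r| by [].
rewrite {1}ler_norml => /andP[Hq1 Hq2].
set d : R := 1 - r - `|q - r| in Hp1 Hp2.
pose g b (e : bool) (x : dihedral) : R[i] :=
  (x == 1%g)%:R + (-1) ^+ e * (x == letter b)%:R.
have pdg b e : positive_definite (g b e).
  exact: (@positive_definite_pair R _ (letter b) e (letter2 b)).
have pdZg (c : R) b e : 0 <= c -> positive_definite (fun x => c%:C%C * g b e x).
  by move=> c0; apply: positive_definiteZ.
(* [d d_1 + (p - r) d_s] and [|q - r| d_1 + (q - r) d_t], each written in the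
   two characters of the corresponding subgroup of order 2, and then [r]. *)
have := positive_definiteD (positive_definiteD
  (positive_definiteD (pdZg ((d + (p - r)) / 2) false false _)
                      (pdZg ((d - (p - r)) / 2) false true _))
  (positive_definiteD (pdZg ((`|q - r| + (q - r)) / 2) true false _)
                      (pdZg ((`|q - r| - (q - r)) / 2) true true _)))
  (positive_definiteZ r0 (@positive_definite_cst1 R dihedral)).
move=> /(_ ltac:(lra) ltac:(lra) ltac:(lra) ltac:(lra)).
apply: eq_positive_definite => x.
have gE b e : g b e x = ((x == 1%g)%:R + (-1) ^+ e * (x == letter b)%:R)%:C%C.
  by rewrite /g rmorphD rmorphM rmorph_sign !rmorph_nat.
rewrite !gE -!rmorphM mulr1 -!rmorphD /=; congr (_%:C)%C.
rewrite /dihedral_fun; case: (eqVneq x 1%g) => [->|x1].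
  by rewrite /= /d; lra.
case: (eqVneq x dihedral_s) => [->|xs]; first by rewrite /=; lra.
by case: (eqVneq x dihedral_t) => _ /=; lra.
Qed.

(** * The characterization *)

(** A sum of two absolute values is at most [1 - r] when all four signed sums
    are. Equal signs give [p + q - 1 <= r] and [r <= (1 + p + q) / 3]; the two
    choices of opposite signs give [r <= 1 - |p - q|], where [r] cancels on the
    left. *)
Lemma norm_sum_le_max_min (R : realType) (p q r : R) :
  0 <= r /\ `|p - r| + `|q - r| <= 1 - r <->
  Num.max 0 (p + q - 1) <= r <= Num.min (1 - `|p - q|) ((1 + p + q) / 3).
Proof.
rewrite ge_max le_min.
case: (ger0P (p - r)) => hp; case: (ger0P (q - r)) => hq;
  case: (ger0P (p - q)) => hpq; split=> [[H1 H2]|/andP[/andP[H1 H2] /andP[H3 H4]]];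
  first [split; lra | apply/andP; split; apply/andP; split; lra].
Qed.

Local Open Scope complex_scope.

Theorem proposition7p3 (R : realType) (p q r : R) :
  (positive_definite (fun w : dihedral => (dihedral_fun p q r w)%:C) <->
     0 <= r /\ `|p - r| + `|q - r| <= 1 - r) /\
  (positive_definite (fun w : dihedral => (dihedral_fun p q r w)%:C) <->
     Num.max 0 (p + q - 1) <= r <=
       Num.min (1 - `|p - q|) ((1 + p + q) / 3)).
Proof.
suff pd_iff : positive_definite (fun w : dihedral => (dihedral_fun p q r w)%:C) <->
    0 <= r /\ `|p - r| + `|q - r| <= 1 - r.
  by split=> //; apply: iff_trans pd_iff (norm_sum_le_max_min p q r).
split=> [pd|[r0 le_pq]]; last exact: positive_definite_dihedral_fun.
split; first exact: limit_value_ge0 pd.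
have signs b c := edge_signs_ge0 pd (fun x => if x then c else b).
have := signs true true; have := signs true false.
have := signs false true; have := signs false false.
rewrite /= !expr0 !expr1 !mul1r !mulN1r.
by case: (ger0P (p - r)) => hp; case: (ger0P (q - r)) => hq; lra.
Qed.
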